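(* Fix an integer $k\geq1$, and for each integer $r$ let $q=2\lceil(k+1)/2\rceil$ and $d=\lfloor r/q\rfloor$. For every $\varepsilon>0$ and all sufficiently large integers $r$ (depending on $k$ and $\varepsilon$), $$(1-\varepsilon)\frac{\ln d}{qd}\leq c_k(r)\leq 1-\frac{r}{(r+1)^{1+1/r}}.$$ Moreover, $c_k(r)\sim(\ln r)/r$ as $r\to\infty$, that is, $\lim_{r\to\infty} \dfrac{c_k(r)}{(\ln r)/r}=1$.
   Context: All graphs are finite, simple and undirected. For a graph $G$ and $v\in V(G)$, $N_G(v)$ is the set of neighbors of $v$, $N_G[v]=N_G(v)\cup\{v\}$, and for $S\subseteq V(G)$, $N_G[S]=\bigcup_{v\in S}N_G[v]$. For an integer $k\ge0$ and $S\subseteq V(G)$, define recursively $P_G^{0}(S)=N_G[S]$ and, for $i\ge0$, $$P_G^{i+1}(S)=\bigcup\{N_G[v]: v\in P_G^{i}(S),\ |N_G[v]\setminus P_G^{i}(S)|\leq k\}.$$ If $P_G^{i_0}(S)=P_G^{i_0+1}(S)$ for some $i_0$, then $P_G^{j}(S)=P_G^{i_0}(S)$ for all $j\ge i_0$, and one sets $P_G^{\infty}(S)=P_G^{i_0}(S)$. The set $S$ is a $k$-power dominating set ($k$-PD-set) of $G$ if $P_G^{\infty}(S)=V(G)$. The $k$-power domination number $\gamma_{P,k}(G)$ is the minimum cardinality of a $k$-PD-set of $G$. The $k$-power domination ratio is $$c_k(r)=\sup\left\{\frac{\gamma_{P,k}(G)}{|V(G)|}: G\text{ is a connected } r\text{-regular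 graph}\right\}.$$ *)

(* Defs.v *)
From HB Require Import structures.
From mathcomp Require Import all_boot all_order all_algebra.
From mathcomp Require Import all_classical all_reals all_analysis.

Set Implicit Arguments.
Unset Strict Implicit.
Unset Printing Implicit Defensive.

Import Order.TTheory GRing.Theory Num.Theory.
Import numFieldNormedType.Exports.

Local Open Scope ring_scope.

Record sgraph := SGraph {
  vertex :> finType;
  adj : rel vertex;
  adj_sym : symmetric adj;
  adj_irrefl : irreflexive adj }.

Section PowerDomination.

Variable G : sgraph.
Implicit Types (v : G) (S : {set G}) (k r i : nat).

Definition nbr v : {set G} := [set u | adj v u]%SET.

Definition cnbr v : {set G} := (v |: nbr v)%SET.

Definition cnbrs S : {set G} := (\bigcup_(v in S) cnbr v)%SET.

Definition regular_graph r : Prop := forall v, #|nbr v| = r.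

(* The null graph is not counted as connected. *)
Definition connected_graph : Prop :=
  (0 < #|G|)%N /\ forall u v, connect (@adj G) u v.

Fixpoint power_dom k S i : {set G} :=
  if i is j.+1 then
    (\bigcup_(v in power_dom k S j | (#|cnbr v :\: power_dom k S j| <= k)%N)
        cnbr v)%SET
  else cnbrs S.

Lemma power_dom_sub k S i : power_dom k S i \subset power_dom k S i.+1.
Proof.
have H v j : cnbr v \subset power_dom k S j -> cnbr v \subset power_dom k S j.+1.
  move=> vj; apply: (@finset.bigcup_sup _ _ v (fun v => (v \in power_dom k S j)
    && (#|cnbr v :\: power_dom k S j| <= k)%N) cnbr).
  rewrite (fintype.subsetP vj) ?finset.setU11 //=.
  by move: vj; rewrite -finset.setD_eq0 => /eqP ->; rewrite cards0.
elim: i => [|i IHi].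
  by apply/finset.bigcupsP => v vS; apply: H; apply: finset.bigcup_sup.
apply/finset.bigcupsP => v /andP[v_in vk]; apply: H.
by apply: (@finset.bigcup_sup _ _ v (fun v => (v \in power_dom k S i)
    && (#|cnbr v :\: power_dom k S i| <= k)%N) cnbr); rewrite v_in.
Qed.

Lemma power_dom_stable k S :
  exists i, power_dom k S i == power_dom k S i.+1.
Proof.
have [/existsP[i Hi]|/existsPn Hn] :=
  boolP [exists i : 'I_(#|G|.+1), power_dom k S i == power_dom k S i.+1].
  by exists i.
suff /(_ #|G|.+1 (leqnn _)) H :
    forall i, (i <= #|G|.+1)%N -> (i <= #|power_dom k S i|)%N.
  by have := leq_trans H (max_card _); rewrite ltnn.
elim=> // i IHi lti; apply: leq_ltn_trans (IHi (ltnW lti)) _.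
by apply: proper_card; rewrite finset.properEneq power_dom_sub andbT; exact: (Hn (Ordinal lti)).
Qed.

(* The common value of the stages from the first stationary index on. *)
Definition power_dom_infty k S : {set G} :=
  power_dom k S (ex_minn (power_dom_stable k S)).

Definition pd_set k S : bool := power_dom_infty k S == [set: G]%SET.

Lemma pd_setT k : pd_set k [set: G]%SET.
Proof.
have H i : power_dom k [set: G]%SET i = [set: G]%SET.
  apply/eqP; rewrite -finset.subTset; elim: i => [|i IHi].
    apply/fintype.subsetP => v _; apply/finset.bigcupP; exists v.
      by rewrite finset.inE.
    exact: finset.setU11.
  exact: fintype.subset_trans IHi (power_dom_sub _ _ _).
by rewrite /pd_set /power_dom_infty H.
Qed.

Definition pd_number k : nat :=
  #|[arg min_(S < [set: G]%SET | pd_set k S) #|S|]|%N.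

Lemma pd_number_le k S : pd_set k S -> (pd_number k <= #|S|)%N.
Proof. by rewrite /pd_number; case: arg_minnP; [exact: pd_setT|move=> A _; apply]. Qed.

Lemma pd_number_attained k : exists2 S, pd_set k S & #|S| = pd_number k.
Proof.
rewrite /pd_number; case: arg_minnP; [exact: pd_setT|move=> A pA _].
by exists A.
Qed.

End PowerDomination.

Definition pd_ratio_set (R : realType) (k r : nat) : set R :=
  [set x : R | exists G : sgraph,
     [/\ connected_graph G, regular_graph G r
       & x = (pd_number G k)%:R / #|G|%:R]]%classic.

Arguments pd_ratio_set : clear implicits.

(* [sup] is only meaningful on nonempty bounded sets; here every ratio is at
   most 1, and the complete graph on [r.+1] vertices makes the set nonempty. *)
Definition pd_ratio (R : realType) (k r : nat) : R := sup (pd_ratio_set R k r).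

Lemma pd_ratio_set_has_sup (R : realType) (k r : nat) :
  has_sup (pd_ratio_set R k r).
Proof.
split; last first.
  exists 1 => _ [G [[G0 _] _ ->]].
  rewrite ler_pdivrMr ?ltr0n // mul1r ler_nat.
  by apply: leq_trans (pd_number_le (pd_setT G k)) (max_card _).
have s : symmetric (fun u v : 'I_r.+1 => u != v) by move=> u v; rewrite eq_sym.
have i : irreflexive (fun u v : 'I_r.+1 => u != v) by move=> u; rewrite eqxx.
exists ((pd_number (SGraph s i) k)%:R / #|SGraph s i|%:R); exists (SGraph s i).
split => //.
- split; first by rewrite card_ord.
  move=> u v; have [->|uv] := eqVneq u v; first exact: connect0.
  exact: connect1.
- move=> v; rewrite /nbr /=.
  have -> : [set u | v != u]%SET = (~: [set v])%SET.
    by apply/setP => u; rewrite !finset.inE eq_sym.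
  by rewrite cardsC1 card_ord.
Qed.

(* Main.v *)
Require Import Defs.
From mathcomp Require Import all_boot all_order all_algebra.
From mathcomp Require Import all_classical all_reals all_analysis.
From mathcomp Require Import zify ring lra.
From mathcomp Require Import fintype finset.

(** The upper bound is the classical one for the domination number, which bounds
    every k-power domination number from above: a random set containing each
    vertex with probability [p], completed by the vertices that it does not
    dominate, has on average a proportion [p + (1 - p) ^+ r.+1] of the vertices
    of an r-regular graph ([dominating_upper_bound]). It gives the stated bound
    for the optimal [p], and at most [(ln r + 1) / r] for [p = ln r / r].

    The lower bound comes from a blow-up. In the lexicographic product [H[B]],
    where each vertex of [H] is replaced by a copy of a graph [B] with more than
    [k] vertices, an outside neighbour of a copy of [B] is adjacent to all of it,
    hence can never force a first vertex of a copy that is wholly unobserved. A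
    k-power dominating set of [H[B]] therefore projects onto a dominating set of
    [H] ([lex_graph_pd_set]). If [H] is d-regular and [B] is s-regular on [q]
    vertices, with [r = q * d + s] and [s < q], then [H[B]] is r-regular; [B]
    exists because [q] is even ([regular_graph_even]).

    There remains to find connected d-regular graphs [H] whose dominating sets
    all contain a proportion [(1 - e) * ln d / d] of the vertices. These are
    bipartite Cayley sum graphs: two copies of a cyclic group of order [M * d],
    [M] being a large constant, with [x] joined to [y] when [x + y \in A]. Such
    a graph is exactly #|A|-regular, and [A] can be taken random. A set [S] of
    [m] vertices on one side fails to dominate [y] exactly when [A] avoids the
    translate [y + S]. Many of these translates are pairwise disjoint
    ([disjoint_translates]), hence independently hit ([Prob_hit_all]), each of
    them being avoided with probability [(1 - 1 / M) ^+ m]. For [m] slightly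
    less than [M * ln d] this is a power of [d] with exponent greater than [-1],
    so that some translate is avoided except with a probability which a union
    bound over all [S] can afford ([sum_avoiding_set], [union_bound_small]). *)

Set Implicit Arguments.
Unset Strict Implicit.
Unset Printing Implicit Defensive.

Import Order.TTheory GRing.Theory Num.Theory.
Import numFieldNormedType.Exports.

Local Open Scope ring_scope.
Local Open Scope set_scope.

(** * Random subsets of a finite type *)

(** The product measure on subsets for which every element is present
    independently with probability [p]. *)
Definition weight (R : realFieldType) (T : finType) (p : R) (A : {set T}) : R :=
  \prod_x (if x \in A then p else 1 - p).

Definition Prob (R : realFieldType) (T : finType) (p : R)
    (E : pred {set T}) : R :=
  \sum_(A | E A) weight p A.

Lemma weight_ge0 (R : realFieldType) (T : finType) (p : R) (A : {set T}) :
  0 <= p <= 1 -> 0 <= weight p A.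
Proof.
move=> /andP[p0 p1]; apply: prodr_ge0 => x _; case: ifP => _ //.
by rewrite subr_ge0.
Qed.

Lemma weight_sum (R : realFieldType) (T : finType) (p : R) :
  \sum_(A : {set T}) weight p A = 1.
Proof.
rewrite /weight -bigA_distr /= big1 // => i _.
by rewrite subrKC.
Qed.

Lemma Prob_ge0 (R : realFieldType) (T : finType) (p : R) (E : pred {set T}) :
  0 <= p <= 1 -> 0 <= Prob p E.
Proof. by move=> p01; apply: sumr_ge0 => A _; exact: weight_ge0. Qed.

Lemma Prob_le1 (R : realFieldType) (T : finType) (p : R) (E : pred {set T}) :
  0 <= p <= 1 -> Prob p E <= 1.
Proof.
move=> p01; rewrite -(weight_sum T p) [leRHS](bigID E) lerDl.
by apply: sumr_ge0 => A _; exact: weight_ge0.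
Qed.

Lemma le_Prob (R : realFieldType) (T : finType) (p : R) (E F : pred {set T}) :
  0 <= p <= 1 -> subpred E F -> Prob p E <= Prob p F.
Proof.
move=> p01 EF; rewrite /Prob big_mkcond [leRHS]big_mkcond.
apply: ler_sum => A _; case: ifP => [/EF -> //|_].
by case: ifP => // _; exact: weight_ge0.
Qed.

Lemma eq_Prob (R : realFieldType) (T : finType) (p : R) (E F : pred {set T}) :
  E =1 F -> Prob p E = Prob p F.
Proof. by move=> EF; apply: eq_bigl. Qed.

Lemma ProbC (R : realFieldType) (T : finType) (p : R) (E : pred {set T}) :
  Prob p (predC E) = 1 - Prob p E.
Proof.
by rewrite /Prob -(weight_sum T p) [in RHS](bigID E) /= addrAC subrr add0r.
Qed.

Lemma Prob_split (R : realFieldType) (T : finType) (p : R)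
    (E F : pred {set T}) :
  Prob p E = Prob p (fun A => E A && F A) + Prob p (fun A => E A && ~~ F A).
Proof. by rewrite /Prob (bigID F). Qed.

Lemma Prob_union (R : realFieldType) (T I : finType) (p : R)
    (E : pred {set T}) (F : I -> pred {set T}) :
  0 <= p <= 1 -> (forall A, E A -> exists i, F i A) ->
  Prob p E <= \sum_i Prob p (F i).
Proof.
move=> p01 EF; rewrite /Prob (exchange_big_dep xpredT) //= big_mkcond /=.
apply: ler_sum => A _; rewrite (big_mkcond (fun i => F i A)).
have le0 i : 0 <= if F i A then weight p A else 0.
  by case: ifP => // _; exact: weight_ge0.
case: ifP => [/EF[i Fi]|_]; last exact: sumr_ge0.
by rewrite (bigD1 i) //= Fi lerDl sumr_ge0.
Qed.

(** Independence of [x \in A] from an event that ignores [x]: adding [x] is a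
    bijection from the sets avoiding [x] to the sets containing it, and it
    multiplies weights by [p / (1 - p)]. *)
Lemma Prob_avoid1 (R : realFieldType) (T : finType) (p : R)
    (E : pred {set T}) (x : T) :
  (forall A, E (x |: A) = E (A :\ x)) ->
  Prob p (fun A => E A && (x \notin A)) = (1 - p) * Prob p E.
Proof.
move=> Ex; rewrite (Prob_split p E (fun A => x \notin A)).
suff H : (1 - p) * Prob p (fun A => E A && ~~ (x \notin A))
    = p * Prob p (fun A => E A && (x \notin A)).
  by rewrite mulrDr H -mulrDl subrK mul1r.
rewrite /Prob !big_distrr /=.
rewrite (reindex_onto (fun A => x |: A) (fun A => A :\ x)) /=; last first.
  by move=> A /andP[_]; rewrite negbK; exact: setD1K.
apply: eq_big => [A|A].
  have [xA|xA] := boolP (x \in A).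
    rewrite !andbF; apply/negbTE; rewrite !negb_and; apply/orP; right.
    by apply/eqP => /setP /(_ x); rewrite !inE eqxx xA.
  have AE : A :\ x = A by apply/setDidPl; rewrite disjoint_sym disjoints1.
  by rewrite Ex setU11 setU1K // eqxx AE !andbT.
move=> /andP[_ /eqP xA].
have xnA : x \notin A by rewrite -xA !inE eqxx.
rewrite /weight (bigD1 x) // [in RHS](bigD1 x) //= setU11 (negbTE xnA).
rewrite mulrCA; congr (_ * (_ * _)); apply: eq_bigr => i ix.
by rewrite !inE (negbTE ix).
Qed.

Lemma disjoint_toggle (T : finType) (x : T) (A B : {set T}) : x \notin B ->
  [disjoint B & x |: A] = [disjoint B & A :\ x].
Proof.
move=> xB; rewrite -!setI_eq0; congr (_ == _); apply/setP => y; rewrite !inE.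
by have [->|] := eqVneq y x; rewrite ?(negbTE xB).
Qed.

Lemma Prob_avoid (R : realFieldType) (T : finType) (p : R)
    (E : pred {set T}) (B : {set T}) :
  (forall x A, x \in B -> E (x |: A) = E (A :\ x)) ->
  Prob p (fun A => E A && [disjoint B & A]) = (1 - p) ^+ #|B| * Prob p E.
Proof.
have [n] := ubnP #|B|; elim: n B E => // n IH B E.
have [->|[x xB]] := set_0Vmem B => sB EB.
  rewrite cards0 mul1r; apply: eq_Prob => A.
  by rewrite -setI_eq0 set0I eqxx andbT.
have cB : #|B| = #|B :\ x|.+1 by rewrite (cardsD1 x) xB.
rewrite cB exprS -mulrA -IH; first last.
- by move=> y A /setD1P[_]; exact: EB.
- by rewrite -ltnS -cB.
rewrite -(@Prob_avoid1 R T p _ x) => [|A]; last first.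
  by rewrite EB // disjoint_toggle // !inE eqxx.
apply: eq_Prob => A; rewrite -andbA !disjoints_subset; congr (_ && _).
by rewrite -[in LHS](setD1K xB) subUset sub1set inE andbC.
Qed.

Lemma Prob_disjoint (R : realFieldType) (T : finType) (p : R) (B : {set T}) :
  Prob p (fun A => [disjoint B & A]) = (1 - p) ^+ #|B|.
Proof.
have := @Prob_avoid R T p xpredT B (fun _ _ _ => erefl).
by rewrite [Prob p xpredT]weight_sum mulr1.
Qed.

Lemma Prob_mem (R : realFieldType) (T : finType) (p : R) (x : T) :
  Prob p (fun A => x \in A) = p.
Proof.
have -> : Prob p (fun A : {set T} => x \in A)
    = Prob p (predC (fun A : {set T} => [disjoint [set x] & A])).
  by apply: eq_Prob => A; rewrite /= disjoints1 negbK.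
by rewrite ProbC Prob_disjoint cards1 expr1 subKr.
Qed.

Lemma mean_card (R : realFieldType) (T : finType) (p : R) :
  \sum_(A : {set T}) weight p A * #|A|%:R = #|T|%:R * p.
Proof.
transitivity (\sum_(x : T) Prob p (fun A => x \in A)); last first.
  by under eq_bigr => x _ do rewrite Prob_mem; rewrite sumr_const mulr_natl.
rewrite /Prob (exchange_big_dep xpredT) //=; apply: eq_bigr => A _.
by rewrite -sum1_card natr_sum mulr_sumr; apply: eq_bigr => x _; rewrite mulr1.
Qed.

(** The targets being disjoint, the random set avoids [F i] with its
    unconditional probability, at least [(1 - p) ^+ m], even when all the other
    targets are known to be hit. *)
Lemma Prob_hit_all (R : realFieldType) (T I : finType) (p : R) (m : nat)
    (F : I -> {set T}) (Y : {set I}) :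
  0 <= p <= 1 -> (forall i, #|F i| <= m)%N ->
  {in Y &, forall i j, i != j -> [disjoint F i & F j]} ->
  Prob p (fun A => [forall i in Y, ~~ [disjoint F i & A]])
    <= (1 - (1 - p) ^+ m) ^+ #|Y|.
Proof.
move=> p01 Fm; have [n] := ubnP #|Y|; elim: n Y => // n IH Y.
have /andP[p0 p1] := p01.
have q01 : 0 <= 1 - p <= 1 by rewrite subr_ge0 p1 lerBlDr lerDl.
have /andP[q0 q1] := q01.
have [->|[i iY]] := set_0Vmem Y => sY YF.
  by rewrite cards0 expr0; exact: Prob_le1.
have cY : #|Y| = #|Y :\ i|.+1 by rewrite (cardsD1 i) iY.
set E := fun A : {set T} => [forall j in Y :\ i, ~~ [disjoint F j & A]].
have EY (A : {set T}) : [forall j in Y, ~~ [disjoint F j & A]]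
    = E A && ~~ [disjoint F i & A].
  apply/forall_inP/andP => [H|[/forall_inP H Hi] j jY].
    by split; [apply/forall_inP => j /setD1P[_]|]; exact: H.
  by have [->//|ji] := eqVneq j i; apply: H; rewrite !inE ji.
rewrite (eq_Prob p EY).
have /eqP := Prob_split p E (fun A => [disjoint F i & A]).
rewrite Prob_avoid => [|x A xF]; last first.
  apply: eq_forallb_in => j /setD1P[ji jY]; rewrite disjoint_toggle //.
  by have := YF _ _ jY iY ji; rewrite disjoint_sym => /disjointFr ->.
rewrite addrC -subr_eq => /eqP <-.
rewrite -{1}[Prob p E]mul1r -mulrBl cY exprS.
apply: ler_pM.
- by rewrite subr_ge0 exprn_ile1.
- exact: Prob_ge0.
- by rewrite lerD2l lerN2 ler_wiXn2l.
- apply: IH; first by rewrite -ltnS -cY.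
  by move=> j l /setD1P[_ jY] /setD1P[_ lY]; exact: YF.
Qed.

(** * Random sets avoiding a translate of every small set *)

(** A maximal family of pairwise disjoint translates of [S] outside [X] is
    large: by maximality, every other admissible shift differs from a chosen
    one by a difference of two elements of [S]. *)
Lemma disjoint_translates (V : finZmodType) (S X : {set V}) : S != set0 ->
  exists Y : {set V}, [/\ [disjoint Y & X],
    {in Y &, forall y z, y != z ->
      [disjoint [set x + y | x in S] & [set x + z | x in S]]}
    & (#|V| <= #|X| + #|Y| * #|S| ^ 2)%N].
Proof.
move=> /set0Pn[s sS].
pose tr y := [set x + y | x in S].
pose P (Y : {set V}) := [disjoint Y & X] &&
  [forall y in Y, forall z in Y, (y != z) ==> [disjoint tr y & tr z]].
have P0 : P set0.
  rewrite /P -setI_eq0 set0I eqxx /=.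
  by apply/forall_inP => y; rewrite inE.
have [Y /maxsetP[/andP[YX YY] Ymax]] := ex_maxset (ex_intro P set0 P0).
exists Y; split => //.
  move=> y z yY zY; apply/implyP.
  by move/forall_inP : YY => /(_ _ yY) /forall_inP; apply.
pose D := [set u.1 + u.2.1 - u.2.2 | u in setX Y (setX S S)].
have cover : ~: X \subset D.
  apply/subsetP => z; rewrite inE => zX.
  have [zY|zY] := boolP (z \in Y).
    apply/imsetP; exists (z, (s, s)); rewrite ?inE /= ?zY ?sS //.
    by rewrite addrK.
  have : ~~ P (z |: Y).
    apply/negP => /Ymax /(_ (subsetUr _ _)) YE.
    by rewrite -YE setU11 in zY.
  rewrite /P setUC -setI_eq0 setIUl.
  have -> : Y :&: X = set0 by apply: disjoint_setI0.
  rewrite set0U setI_eq0 disjoints1 zX /=.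
  have meet y : y \in Y -> ~~ [disjoint tr y & tr z] -> z \in D.
    move=> yY /pred0Pn[w /andP[/imsetP[a aS ->] /imsetP[b bS ab]]].
    apply/imsetP; exists (y, (a, b)); rewrite ?inE /= ?yY ?aS //.
    by rewrite [y + a]addrC ab addrAC subrr add0r.
  rewrite negb_forall_in => /exists_inP[y yYz].
  rewrite negb_forall_in => /exists_inP[w wYz]; rewrite negb_imply => /andP[yw].
  move: yYz wYz; rewrite !inE => /orP[yY|/eqP yz] /orP[wY|/eqP wz].
  - by move/forall_inP : YY => /(_ _ yY) /forall_inP /(_ _ wY); rewrite yw /= => ->.
  - by rewrite wz; exact: meet.
  - by rewrite yz disjoint_sym; exact: meet.
  - by rewrite yz wz eqxx in yw.
have := subset_leq_card cover; rewrite cardsCs setCK leq_subLR => /leq_trans; apply.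
rewrite leq_add2l; apply: leq_trans (leq_imset_card _ _) _.
by rewrite !cardsX.
Qed.

Lemma small_set_ffun (V : finType) (x0 : V) (m : nat) (S : {set V}) :
  (#|S| <= m)%N -> exists f : {ffun 'I_m -> V}, S \subset [set f i | i in setT].
Proof.
move=> Sm; exists [ffun i : 'I_m => nth x0 (enum S) i].
apply/subsetP => x xS; have xi : (index x (enum S) < m)%N.
  by apply: leq_trans Sm; rewrite cardE index_mem mem_enum.
by apply/imsetP; exists (Ordinal xi); rewrite // ffunE nth_index // mem_enum.
Qed.

(** The set is random. It is bad for given [S] and [X] when it meets [y + S]
    for each [y] outside [X], in particular for each [y] in a family of disjoint
    translates; the hypothesis makes the sum of these probabilities over the
    [#|V| ^ (m + n)] choices of [S] and [X] less than [1 / #|V|]. On the other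
    hand the size of the random set has mean at least [d] and never exceeds
    [#|V|], so it reaches [d] with probability at least [1 / #|V|]. *)
Lemma sum_avoiding_set (R : realFieldType) (V : finZmodType) (p : R)
    (m n d : nat) :
  0 <= p <= 1 -> (0 < m)%N -> (0 < d)%N -> d%:R <= #|V|%:R * p ->
  (forall y, (#|V| <= n + y * m ^ 2)%N ->
     #|V|%:R ^+ (m + n).+1 * (1 - (1 - p) ^+ m) ^+ y < 1) ->
  exists2 A : {set V}, (d <= #|A|)%N &
    forall S X : {set V}, (#|S| <= m)%N -> (#|X| <= n)%N ->
      exists2 y, y \notin X & forall x, x \in S -> x + y \notin A.
Proof.
move=> p01 m0 d0 dVp small.
have V0 : 0 < #|V|%:R :> R by rewrite ltr0n; apply/card_gt0P; exists 0.
(* Sets of bounded size are enlarged to images of [m]- and [n]-tuples, of which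
   there are [#|V| ^ (m + n)]. *)
pose I := ({ffun 'I_m -> V} * {ffun 'I_n -> V})%type.
pose bad (u : I) (A : {set V}) :=
  [forall y, (y \in [set u.2 i | i in setT]) || [exists i, u.1 i + y \in A]].
pose E (A : {set V}) := [exists u, bad u A].
have PE : Prob p E * #|V|%:R < 1.
  have PE' : Prob p E <= \sum_u Prob p (bad u).
    by apply: Prob_union => // A /existsP.
  rewrite -ltr_pdivlMr // mul1r; apply: le_lt_trans PE' _.
  have -> : #|V|%:R^-1 = \sum_(u : I) (#|V|%:R ^+ (m + n).+1)^-1 :> R.
    rewrite sumr_const card_prod !card_ffun !card_ord -expnD -[RHS]mulr_natl natrX.
    by rewrite exprSr invfM mulrA divff ?mul1r // expf_neq0 ?gt_eqF.
  apply: ltr_sum => [|u _].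
    apply/hasP; exists ([ffun=> 0], [ffun=> 0]) => //; exact: mem_index_enum.
  rewrite -[X in _ < X]mul1r ltr_pdivlMr ?exprn_gt0 // mulrC.
  set S := [set u.1 i | i in setT]; set X := [set u.2 i | i in setT].
  have Sn0 : S != set0.
    by apply/set0Pn; exists (u.1 (Ordinal m0)); exact: imset_f.
  have Sm : (#|S| <= m)%N.
    by apply: leq_trans (leq_imset_card _ _) _; rewrite cardsT card_ord.
  have Xn : (#|X| <= n)%N.
    by apply: leq_trans (leq_imset_card _ _) _; rewrite cardsT card_ord.
  have [Y [YX YY cY]] := disjoint_translates X Sn0.
  have /small : (#|V| <= n + #|Y| * m ^ 2)%N.
    by apply: leq_trans cY (leq_add Xn _); rewrite leq_mul2l leq_sqr Sm orbT.
  apply: le_lt_trans; rewrite ler_pM2l ?exprn_gt0 //.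
  pose F y := [set x + y | x in S].
  have Fm y : (#|F y| <= m)%N by apply: leq_trans (leq_imset_card _ _) Sm.
  apply: le_trans (Prob_hit_all p01 Fm YY); apply: le_Prob => // A /forallP badA.
  apply/forall_inP => y yY; apply/pred0Pn.
  move: (badA y); rewrite -/X (disjointFr YX yY) /= => /existsP[i iA].
  by exists (u.1 i + y); rewrite /= iA andbT; apply: imset_f; exact: imset_f.
have [/existsP[A /andP[dA nE]]|noA] :=
    boolP [exists A : {set V}, (d <= #|A|)%N && ~~ E A].
  exists A => // S X Sm Xn.
  have [f Sf] := small_set_ffun 0 Sm.
  have [g Xg] := small_set_ffun 0 Xn.
  have : ~~ bad (f, g) A by apply: contra nE => ?; apply/existsP; exists (f, g).
  rewrite negb_forall => /existsP[y]; rewrite negb_or negb_exists /=.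
  move=> /andP[yg /forallP yf]; exists y.
    by apply: contra yg; exact: (subsetP Xg).
  by move=> x /(subsetP Sf) /imsetP[i _ ->]; exact: yf.
(* Otherwise every good set has at most [d - 1] elements, which makes the mean
   size smaller than [d]. *)
exfalso; move: dVp; rewrite -mean_card leNgt => /negP; apply.
have -> : d%:R = 1 + d.-1%:R :> R by rewrite -[in LHS](prednK d0) -nat1r.
rewrite (bigID E) /=; apply: ltr_leD.
  apply: le_lt_trans PE; rewrite /Prob mulr_suml; apply: ler_sum => A _.
  by apply: ler_wpM2l; [exact: weight_ge0|rewrite ler_nat max_card].
apply: (@le_trans _ _ (Prob p (predC E) * d.-1%:R)); last first.
  by rewrite ler_piMl // Prob_le1.
rewrite /Prob mulr_suml; apply: ler_sum => A nE.
apply: ler_wpM2l; first exact: weight_ge0.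
rewrite ler_nat -ltnS prednK // ltnNge; apply: contra noA => dA.
by apply/existsP; exists A; rewrite dA.
Qed.

(** * Domination and power domination of regular graphs *)

Lemma mem_cnbrs (G : sgraph) (S : {set G}) (v : G) :
  (v \in cnbrs S) = (v \in S) || [exists u in S, adj u v].
Proof.
apply/bigcupP/orP => [[u uS]|[vS|/exists_inP[u uS uv]]].
- rewrite !inE => /orP[/eqP ->|uv]; first by left.
  by right; apply/exists_inP; exists u.
- by exists v => //; rewrite setU11.
- by exists u => //; rewrite !inE uv orbT.
Qed.

Lemma card_cnbr (G : sgraph) (r : nat) (v : G) :
  regular_graph G r -> #|cnbr v| = r.+1.
Proof. by move=> Gr; rewrite cardsU1 Gr inE adj_irrefl. Qed.

Lemma dominating_pd_set (G : sgraph) (k : nat) (D : {set G}) :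
  cnbrs D = setT -> pd_set k D.
Proof.
move=> DT; rewrite /pd_set /power_dom_infty; move: (ex_minn _) => i.
rewrite -subTset -DT; elim: i => // i IH.
exact: subset_trans IH (power_dom_sub _ _ _).
Qed.

(** Take a random set together with the vertices that it fails to dominate; a
    vertex is left undominated when the set avoids its closed neighbourhood. *)
Lemma dominating_upper_bound (R : realFieldType) (G : sgraph) (r : nat)
    (p : R) : 0 <= p <= 1 -> regular_graph G r ->
  exists2 D : {set G}, cnbrs D = setT &
    #|D|%:R <= #|G|%:R * (p + (1 - p) ^+ r.+1).
Proof.
move=> p01 Gr; pose U (A : {set G}) := [set v | [disjoint cnbr v & A]].
have mean : \sum_(A : {set G}) weight p A * (#|A|%:R + #|U A|%:R)
    = #|G|%:R * (p + (1 - p) ^+ r.+1).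
  under eq_bigr => A _ do rewrite mulrDr.
  rewrite big_split /= mean_card mulrDr; congr (_ + _).
  transitivity (\sum_(v : G) Prob p (fun A => [disjoint cnbr v & A])).
    rewrite /Prob (exchange_big_dep xpredT) //=; apply: eq_bigr => A _.
    rewrite -sum1_card natr_sum mulr_sumr; apply: eq_big => [v|v _].
      by rewrite inE.
    by rewrite mulr1.
  under eq_bigr => v _ do rewrite Prob_disjoint (card_cnbr _ Gr).
  by rewrite sumr_const mulr_natl.
have [A Amean] : exists A : {set G},
    (#|A|%:R + #|U A|%:R : R) <= #|G|%:R * (p + (1 - p) ^+ r.+1).
  (* If every value exceeded the mean, all the weights would vanish. *)
  apply/not_existsP => big.
  pose W := #|G|%:R * (p + (1 - p) ^+ r.+1).
  have : \sum_(A : {set G}) weight p A * (#|A|%:R + #|U A|%:R - W) = 0.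
    under eq_bigr => A _ do rewrite mulrBr.
    by rewrite sumrB mean -mulr_suml weight_sum mul1r subrr.
  have pos (A : {set G}) : 0 < #|A|%:R + #|U A|%:R - W.
    by rewrite subr_gt0 ltNge; apply/negP; exact: big.
  move=> /eqP; rewrite psumr_eq0 => [/allP zero|A _]; last first.
    by rewrite mulr_ge0 ?weight_ge0 // ltW.
  have w0 (A : {set G}) : weight p A = 0.
    have /= := zero A (mem_index_enum A).
    by rewrite mulf_eq0 (gt_eqF (pos A)) orbF => /eqP.
  have := oner_neq0 R; rewrite -(weight_sum G p).
  by under eq_bigr => A _ do rewrite w0; rewrite big1_eq eqxx.
exists (A :|: U A); last first.
  apply: le_trans Amean; rewrite -natrD ler_nat.
  by rewrite cardsU leq_subr.
apply/setP => v; rewrite mem_cnbrs !inE.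
have [//|/pred0Pn[u /andP[/= uv uA]]] := boolP [disjoint cnbr v & A].
  by rewrite orbT.
move: uv; rewrite orbF !inE => /orP[/eqP uv|vu]; first by rewrite -uv uA.
by apply/orP; right; apply/exists_inP; exists u; rewrite ?inE ?uA // adj_sym.
Qed.

Lemma pd_ratio_le (R : realType) (k r : nat) (p : R) : 0 <= p <= 1 ->
  pd_ratio R k r <= p + (1 - p) ^+ r.+1.
Proof.
move=> p01; have [nonempty _] := pd_ratio_set_has_sup R k r.
apply: ge_sup => // _ [G [[G0 _] Gr ->]].
rewrite ler_pdivrMr ?ltr0n // mulrC.
have [D DT Dp] := dominating_upper_bound p01 Gr.
apply: le_trans Dp; rewrite ler_nat; apply: pd_number_le.
exact: dominating_pd_set.
Qed.

(** * Complements and bipartite sum graphs *)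

Definition compl_adj (G : sgraph) : rel G := fun u v => (u != v) && ~~ adj u v.

Lemma compl_adj_sym (G : sgraph) : symmetric (@compl_adj G).
Proof. by move=> u v; rewrite /compl_adj eq_sym adj_sym. Qed.

Lemma compl_adj_irrefl (G : sgraph) : irreflexive (@compl_adj G).
Proof. by move=> u; rewrite /compl_adj eqxx. Qed.

Definition compl_graph (G : sgraph) : sgraph :=
  SGraph (@compl_adj_sym G) (@compl_adj_irrefl G).

Lemma compl_graph_regular (G : sgraph) (r : nat) :
  regular_graph G r -> regular_graph (compl_graph G) (#|G| - r.+1).
Proof.
move=> Gr v; have -> : nbr (v : compl_graph G) = ~: cnbr (v : G).
  by apply/setP => u; rewrite !inE negb_or eq_sym.
by rewrite cardsCs setCK (@card_cnbr G r v Gr).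
Qed.

Definition sum_adj (V : finZmodType) (A : {set V}) : rel (bool * V)%type :=
  fun u v => (u.1 != v.1) && (u.2 + v.2 \in A).

Lemma sum_adj_sym (V : finZmodType) (A : {set V}) : symmetric (sum_adj A).
Proof. by move=> u v; rewrite /sum_adj eq_sym addrC. Qed.

Lemma sum_adj_irrefl (V : finZmodType) (A : {set V}) : irreflexive (sum_adj A).
Proof. by move=> u; rewrite /sum_adj eqxx. Qed.

(** The bipartite Cayley sum graph: it is regular of degree [#|A|] whatever
    [A] is, and its two sides play the same role. *)
Definition sum_graph (V : finZmodType) (A : {set V}) : sgraph :=
  SGraph (@sum_adj_sym V A) (@sum_adj_irrefl V A).

Lemma sum_graph_regular (V : finZmodType) (A : {set V}) :
  regular_graph (sum_graph A) #|A|.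
Proof.
move=> [b x]; rewrite -(card_imset (mem A) (f := fun a => (~~ b, a - x))).
  apply: eq_card => -[c y]; rewrite !inE /= /sum_adj /=.
  apply/andP/imsetP => [[bc xyA]|[a aA [-> ->]]].
    by exists (x + y) => //; rewrite addrAC subrr add0r; case: b c bc => [] [].
  by rewrite addrC subrK; case: b.
by move=> a a' [/addIr].
Qed.

Lemma card_sum_graph (V : finZmodType) (A : {set V}) :
  #|sum_graph A| = (2 * #|V|)%N.
Proof. by rewrite card_prod card_bool. Qed.

(** Walking along the sums [0] and [g] alternately moves by [g] within one
    side. *)
Lemma sum_graph_connected (V : finZmodType) (A : {set V}) (g : V) :
  (forall x, exists n, x = g *+ n) -> 0 \in A -> g \in A ->
  connected_graph (sum_graph A).
Proof.
move=> gen A0 Ag.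
have side n : connect (@adj (sum_graph A)) (false, 0) (false, g *+ n).
  elim: n => [|n IH]; first exact: connect0.
  apply: connect_trans IH _; apply: (@connect_trans _ _ (true, - (g *+ n))).
    by apply: connect1; rewrite /= /sum_adj /= subrr.
  by apply: connect1; rewrite /= /sum_adj /= mulrSr addKr.
have root u : connect (@adj (sum_graph A)) (false, 0) u.
  case: u => [[] x].
    have [n xn] := gen (- x); apply: connect_trans (side n) _.
    by apply: connect1; rewrite /= /sum_adj /= -xn addNr.
  by have [n ->] := gen x; exact: side.
split; first by apply/card_gt0P; exists (false, 0).
move=> u v; apply: connect_trans (root v).
by rewrite (sym_connect_sym (@adj_sym (sum_graph A))); exact: root.
Qed.

(** If [2 * m] vertices were enough, one of the two sides would contain a set
    [S] of at most [m] of them, and each vertex of the other side would be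
    dominated by [S] or chosen itself. The sums [0] and [g], which serve to make
    the graph connected, only let [S] dominate [2 * m] more vertices; adding
    these to the chosen ones gives an exceptional set of size [4 * m]. *)
Lemma sum_graph_domination (V : finZmodType) (g : V) (A0 A : {set V})
    (m : nat) (E : {set sum_graph A}) :
  (forall S X : {set V}, (#|S| <= m)%N -> (#|X| <= 4 * m)%N ->
     exists2 y, y \notin X & forall x, x \in S -> x + y \notin A0) ->
  A \subset [set 0; g] :|: A0 -> cnbrs E = setT -> (2 * m < #|E|)%N.
Proof.
move=> avoid AA0 ET; rewrite ltnNge; apply/negP => Em.
pose side b := [set x | (b, x) \in E].
have cE : (#|side true| + #|side false| <= #|E|)%N.
  pose e b := [set (b, x) | x in side b].
  have ce b : #|side b| = #|e b| by rewrite card_imset // => x y [].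
  rewrite !ce -cardsUI.
  have -> : e true :&: e false = set0.
    apply/setP => u; rewrite !inE; apply/negbTE/negP.
    by move=> /andP[/imsetP[x _ ->] /imsetP[y _]].
  rewrite cards0 addn0; apply: subset_leq_card; apply/subsetP => u.
  by rewrite inE => /orP[] /imsetP[x] /[!inE] xE ->.
have [b bm] : exists b, (#|side b| <= m)%N.
  have [tm|mt] := leqP #|side true| m; first by exists true.
  exists false; rewrite leqNgt; apply/negP => mf.
  have := leq_trans (leq_add mt mf) (leq_trans cE Em).
  by rewrite mul2n -addnn addSn addnS ltnNge leqnSn.
pose S := side b.
pose X := side (~~ b) :|: ([set - x | x in S] :|: [set g - x | x in S]).
have Xm : (#|X| <= 4 * m)%N.
  apply: leq_trans (leq_card_setU _ _).1 _.
  rewrite (_ : 4 * m = 2 * m + (m + m))%N; last by rewrite addnn -mul2n -mulnDl.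
  apply: leq_add.
    apply: leq_trans Em; apply: leq_trans cE.
    by case: (b); rewrite /= ?leq_addl ?leq_addr.
  apply: leq_trans (leq_card_setU _ _).1 _.
  by apply: leq_add; apply: leq_trans (leq_imset_card _ _) bm.
have [y yX yS] := avoid S X bm Xm.
have := in_setT ((~~ b, y) : sum_graph A); rewrite -ET mem_cnbrs.
move: yX; rewrite !inE !negb_or => /andP[/negbTE -> /andP[y0 yg]] /=.
move=> /exists_inP[[c x]] xE; rewrite /= /sum_adj /= => /andP[cb].
have {cb}cb : c = b by case: c b cb {xE bm S X Xm yS y0 yg avoid} => [] [].
have xS : x \in S by rewrite inE -cb.
move=> /(subsetP AA0); rewrite !inE (negbTE (yS _ xS)) orbF => /orP[/eqP|/eqP] xy.
  by case/imsetP: y0; exists x => //; apply/eqP; rewrite -addr_eq0 addrC xy.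
by case/imsetP: yg; exists x => //; rewrite -xy addrAC subrr add0r.
Qed.

Lemma set_between (T : finType) (B C : {set T}) (d : nat) :
  B \subset C -> (#|B| <= d <= #|C|)%N ->
  exists A : {set T}, [/\ B \subset A, A \subset C & #|A| = d].
Proof.
move=> BC /andP[Bd dC]; move: {2}(d - #|B|)%N (erefl (d - #|B|)%N) => n.
elim: n B BC Bd => [|n IH] B BC Bd dB.
  by exists B; split => //; apply/eqP; rewrite eqn_leq Bd -subn_eq0 dB.
have : B \proper C.
  rewrite properEcard BC (leq_trans _ dC) // -subn_gt0 dB //.
move=> /properP[_ [x xC xB]].
have cB : #|x |: B| = #|B|.+1 by rewrite cardsU1 xB.
have [||| A [BA AC Ad]] := IH (x |: B).
- by rewrite subUset sub1set xC.
- by rewrite cB -subn_gt0 dB.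
- by rewrite cB subnS dB.
by exists A; split => //; apply: subset_trans BA; exact: subsetUr.
Qed.

(** The connection set combines the two elements [0] and [1] of a cyclic group,
    which make the graph connected, with [d - 2] elements of a set avoiding a
    translate of every small set. *)
Lemma regular_graph_no_small_domination (R : realFieldType) (p : R)
    (N m d : nat) :
  0 <= p <= 1 -> (0 < m)%N -> (1 < d)%N -> (1 < N)%N -> d%:R <= N%:R * p ->
  (forall y, (N <= 4 * m + y * m ^ 2)%N ->
     N%:R ^+ (m + 4 * m).+1 * (1 - (1 - p) ^+ m) ^+ y < 1) ->
  exists H : sgraph, [/\ connected_graph H, regular_graph H d,
    #|H| = (2 * N)%N
    & forall D : {set H}, cnbrs D = setT -> (2 * m < #|D|)%N].
Proof.
case: N => [|[|N]] // p01 m0 d1 _ dNp small.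
pose V := 'I_N.+2; have cV : #|V| = N.+2 by rewrite card_ord.
have [|||A0 dA0 avoid] := @sum_avoiding_set R V p m (4 * m) d p01 m0.
- exact: ltnW.
- by rewrite cV.
- by rewrite cV.
pose g : V := 1.
have [||A [gA AA0 Ad]] := @set_between V [set 0; g] ([set 0; g] :|: A0) d.
- exact: subsetUl.
- rewrite cards2 eq_sym oner_eq0 /= d1 (leq_trans dA0) // subset_leq_card //.
  exact: subsetUr.
move: gA; rewrite subUset !sub1set => /andP[A_0 A_g].
exists (sum_graph A); split.
- apply: sum_graph_connected A_0 A_g => x; exists x.
  by rewrite /g natr_Zp.
- by rewrite -Ad; exact: sum_graph_regular.
- by rewrite card_sum_graph cV.
- by move=> D; exact: sum_graph_domination avoid AA0.
Qed.

Lemma set_of_card (T : finType) (n : nat) :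
  (n <= #|T|)%N -> exists A : {set T}, #|A| = n.
Proof.
move=> nT; have [||A [_ _ An]] := @set_between T set0 setT n; last by exists A.
  exact: sub0set.
by rewrite cards0 cardsT.
Qed.

(** Up to degree [h] there is a bipartite one; the others are complements. *)
Lemma regular_graph_even (h s : nat) : (s < 2 * h)%N ->
  exists2 B : sgraph, #|B| = (2 * h)%N & regular_graph B s.
Proof.
case: h => // h sh.
have low t : (t <= h.+1)%N ->
    exists2 B : sgraph, #|B| = (2 * h.+1)%N & regular_graph B t.
  move=> th; have [|A At] := @set_of_card 'I_h.+1 t; first by rewrite card_ord.
  exists (sum_graph A); first by rewrite card_sum_graph card_ord.
  by rewrite -At; exact: sum_graph_regular.
have [/low//|hs] := leqP s h.+1.
have [|B cB Br] := low (2 * h.+1 - s.+1)%N.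
  by rewrite leq_subLR mul2n -addnn leq_add2r ltnW // ltnW.
exists (compl_graph B); first exact: cB.
have := compl_graph_regular Br; rewrite cB.
by rewrite -subSn // subSS subKn // ltnW.
Qed.

(** * Lexicographic products *)

Definition lex_adj (H B : sgraph) : rel (H * B)%type :=
  fun u v => adj u.1 v.1 || ((u.1 == v.1) && adj u.2 v.2).

Lemma lex_adj_sym (H B : sgraph) : symmetric (@lex_adj H B).
Proof. by move=> u v; rewrite /lex_adj adj_sym eq_sym [adj u.2 _]adj_sym. Qed.

Lemma lex_adj_irrefl (H B : sgraph) : irreflexive (@lex_adj H B).
Proof. by move=> u; rewrite /lex_adj !adj_irrefl andbF. Qed.

(** The lexicographic product [H[B]]. *)
Definition lex_graph (H B : sgraph) : sgraph :=
  SGraph (@lex_adj_sym H B) (@lex_adj_irrefl H B).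

Lemma lex_graph_regular (H B : sgraph) (d s : nat) :
  regular_graph H d -> regular_graph B s ->
  regular_graph (lex_graph H B) (d * #|B| + s).
Proof.
move=> Hd Bs [x b].
have -> : nbr ((x, b) : lex_graph H B)
    = setX (nbr x) setT :|: setX [set x] (nbr b).
  by apply/setP => -[y c]; rewrite !inE /= /lex_adj /= andbT [y == x]eq_sym.
rewrite cardsU !cardsX cardsT cards1 mul1n Hd Bs.
have -> : setX (nbr x) setT :&: setX [set x] (nbr b) = set0.
  apply/setP => -[y c]; rewrite !inE /=.
  by have [->|] := eqVneq y x; rewrite ?adj_irrefl //= andbF.
by rewrite cards0 subn0.
Qed.

Lemma lex_graph_connected (H B : sgraph) (d : nat) :
  connected_graph H -> regular_graph H d -> (0 < d)%N -> (0 < #|B|)%N ->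
  connected_graph (lex_graph H B).
Proof.
move=> [H0 Hconn] Hd d0 B0; split; first by rewrite card_prod muln_gt0 H0.
move=> [x b] [y c]; have /card_gt0P[z] : (0 < #|nbr y|)%N by rewrite Hd.
(* A walk in [H] lifts with a constant second coordinate; only its last step,
   from [z] to [y], changes that coordinate. *)
rewrite inE => yz; apply: (@connect_trans _ _ (z, b)); last first.
  by apply: connect1; rewrite /= /lex_adj /= adj_sym yz.
have /connectP[p + ->] := Hconn x z.
elim: p x => [|x' p IH] x /=; first by rewrite connect0.
move=> /andP[xx' /IH]; apply: connect_trans.
by apply: connect1; rewrite /= /lex_adj /= xx'.
Qed.

(** As long as a copy of [B] is unobserved, each outside vertex adjacent to it
    has more than [k] unobserved neighbours; so power domination never enters
    the copies that are not dominated at the start. *)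
Lemma lex_graph_pd_set (H B : sgraph) (k : nat) (S : {set lex_graph H B}) :
  (k < #|B|)%N -> pd_set k S -> cnbrs [set u.1 | u in S] = setT.
Proof.
move=> kB /eqP ST; apply/setP => x; rewrite [RHS]inE; apply/negPn/negP => xS.
suff unseen i b : (x, b) \notin power_dom k S i.
  have /card_gt0P[b _] : (0 < #|B|)%N by apply: leq_ltn_trans kB.
  by have := unseen (ex_minn (power_dom_stable k S)) b; rewrite [power_dom _ _ _]ST inE.
elim: i b => [|i IH] b.
  rewrite [_ \in _](mem_cnbrs S ((x, b) : lex_graph H B)).
  apply: contra xS => xb.
  rewrite mem_cnbrs; case/orP: xb => [xb|/exists_inP[[y c] yS]].
    by apply/orP; left; apply/imsetP; exists (x, b).
  rewrite /= /lex_adj /= => /orP[yx|/andP[/eqP yx _]].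
    by apply/orP; right; apply/exists_inP; exists y => //; exact: imset_f yS.
  by apply/orP; left; rewrite -yx; exact: imset_f yS.
apply/negP => /bigcupP[[y c] /andP[yP yk]].
have ynx : y != x by apply: contraTneq yP => ->; exact: IH.
rewrite !inE xpair_eqE [x == y]eq_sym (negbTE ynx) /= /lex_adj /= (negbTE ynx) orbF.
move=> yx; move: kB; rewrite ltnNge => /negP; apply; apply: leq_trans yk.
rewrite -(card_imset predT (f := pair x)); last by move=> a a' [].
apply: subset_leq_card; apply/subsetP => _ /imsetP[a _ ->].
by rewrite !inE (negbTE (IH a)) /= /lex_adj /= yx orbT.
Qed.

Lemma pd_number_lex_graph (H B : sgraph) (k t : nat) :
  (k < #|B|)%N -> (forall D : {set H}, cnbrs D = setT -> (t <= #|D|)%N) ->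
  (t <= pd_number (lex_graph H B) k)%N.
Proof.
move=> kB Ht; have [S /(lex_graph_pd_set kB) /Ht tS <-] :=
  pd_number_attained (lex_graph H B) k.
exact: leq_trans tS (leq_imset_card _ _).
Qed.

(** Division with remainder of the degree by [2 * h]: each vertex of [H] is
    blown up into a graph that makes up for the remainder, and the evenness of
    [2 * h] ensures that such a graph exists. *)
Lemma pd_ratio_ge (R : realType) (H : sgraph) (k h d s t : nat) :
  connected_graph H -> regular_graph H d ->
  (forall D : {set H}, cnbrs D = setT -> (t <= #|D|)%N) ->
  (0 < d)%N -> (k < 2 * h)%N -> (s < 2 * h)%N ->
  t%:R / (#|H| * (2 * h))%:R <= pd_ratio R k (d * (2 * h) + s).
Proof.
move=> Hconn Hd Ht d0 kh /regular_graph_even[B cB Bs].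
have B0 : (0 < #|B|)%N by rewrite cB; apply: leq_ltn_trans kh.
have [_ bounded] := pd_ratio_set_has_sup R k (d * (2 * h) + s).
have kB : (k < #|B|)%N by rewrite cB.
apply: (@le_trans _ _
  ((pd_number (lex_graph H B) k)%:R / #|lex_graph H B|%:R)).
  rewrite card_prod cB ler_pM2r ?ler_nat; first exact: pd_number_lex_graph.
  have [H0 _] := Hconn.
  by rewrite invr_gt0 ltr0n muln_gt0 H0 -cB.
apply: ub_le_sup => //; exists (lex_graph H B); split => //.
  exact: lex_graph_connected Hd d0 B0.
by rewrite -cB; exact: lex_graph_regular.
Qed.

(** * Asymptotic estimates *)

Lemma ln_nat_large (R : realType) (K : R) :
  exists n0 : nat, forall n : nat, (n0 <= n)%N -> (0 < n)%N /\ K <= ln n%:R.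
Proof.
exists (Num.truncn (expR K)).+1 => n nK; have n0 : (0 < n)%N by case: n nK.
split=> //; rewrite -[K]expRK ler_ln ?posrE ?expR_gt0 ?ltr0n //.
by apply: le_trans (ltW (truncnS_gt _)) _; rewrite ler_nat.
Qed.

Lemma onem_inv_exp_ge (R : realType) (M m : nat) : (1 < M)%N ->
  expR (- (m%:R / (M%:R - 1))) <= (1 - M%:R^-1) ^+ m :> R.
Proof.
move=> M1; have M1' : 1 < M%:R :> R by rewrite ltr1n.
rewrite mulrC -mulNr expRM_natr; apply: lerXn2r; rewrite ?nnegrE ?expR_ge0 //.
  by rewrite subr_ge0 invf_le1 ?ltW // (lt_trans ltr01).
rewrite expRN -[leRHS]invrK lef_pV2 ?posrE ?expR_gt0 //; last first.
  by rewrite invr_gt0 subr_gt0 invf_lt1 // (lt_trans ltr01).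
apply: le_trans (expR_ge1Dx _); rewrite le_eqVlt; apply/orP; left; apply/eqP.
by field; apply/andP; split; rewrite gt_eqF //; lra.
Qed.

(** For [m] of order [M * ln d], the number of pairs of exceptional sets is the
    exponential of a polynomial in [ln d], while the failure probability is the
    exponential of minus a positive power of [d], up to logarithmic factors:
    since [m <= (1 - e / 2) * (M - 1) * ln d], a vertex stays undominated with
    probability [rho >= d ^ - (1 - e / 2)], and [rho * (M * d)] is at least
    [expR (e / 2 * ln d)]. The threshold on [ln d] is the one beyond which
    [x ^+ 5 / 5`! <= expR x] makes this exponential exceed
    [16 * (M * ln d) ^+ 4]. *)
Lemma union_bound_small (R : realType) (e : R) (M d m y : nat) :
  0 < e < 1 -> (1 < M)%N -> (0 < d)%N ->
  (16 * 120 * 32) * M%:R ^+ 4 / e ^+ 5 <= ln (d%:R : R) ->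
  m%:R <= (1 - e / 2) * (M%:R - 1) * ln (d%:R : R) ->
  (M * d <= 4 * m + y * m ^ 2)%N ->
  (M * d)%:R ^+ (m + 4 * m).+1 * (1 - (1 - (M%:R : R)^-1) ^+ m) ^+ y < 1.
Proof.
move=> /andP[e0 e1] M1 d0 dlarge mle Nle.
set L := ln d%:R in dlarge mle *.
have M1' : 2 <= M%:R :> R by rewrite ler_nat.
have d0' : 0 < d%:R :> R by rewrite ltr0n.
have dL : d%:R = expR L by rewrite lnK.
have e5 : 0 < e ^+ 5 by rewrite exprn_gt0.
have e51 : e ^+ 5 <= 1 by rewrite exprn_ile1 // ltW.
have M4 : M%:R <= M%:R ^+ 4 :> R by apply: ler_eXnr => //; lra.
have LM : (16 * 120 * 32) * M%:R ^+ 4 <= L.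
  by apply: le_trans dlarge; rewrite ler_pdivlMr // ler_piMr.
have L1 : 1 <= L by lra.
have lnN : ln (M * d)%:R <= 2 * L.
  rewrite natrM lnM ?posrE ?ltr0n //; last exact: ltnW.
  rewrite (_ : 2 * L = L + L); last by ring.
  rewrite lerD2r -[leRHS]expRK ler_ln ?posrE ?expR_gt0 ?ltr0n //; last exact: ltnW.
  by apply: le_trans (expR_ge1Dx _); lra.
set rho := (1 - M%:R^-1) ^+ m.
have rho1 : rho <= 1.
  have : 0 < (M%:R : R)^-1 <= 1 by rewrite invr_gt0 invf_le1; lra.
  by move=> ?; apply: exprn_ile1; lra.
have rhoL : expR (- ((1 - e / 2) * L)) <= rho.
  apply: le_trans (onem_inv_exp_ge R m M1); rewrite ler_expR lerN2.
  by rewrite ler_pdivrMr; [rewrite mulrAC|lra].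
have rho0 : 0 < rho by apply: lt_le_trans rhoL; exact: expR_gt0.
apply: (@le_lt_trans _ _ (expR ((m + 4 * m).+1%:R * ln (M * d)%:R - rho * y%:R))).
  rewrite expRD expRM_natl lnK; last by rewrite posrE ltr0n muln_gt0 d0 ltnW.
  rewrite -mulNr expRM_natr ler_pM2l; last first.
    by rewrite exprn_gt0 // ltr0n muln_gt0 d0 ltnW.
  apply: lerXn2r; rewrite ?nnegrE ?expR_ge0 ?subr_ge0 //.
  exact: expR_ge1Dx.
rewrite expR_lt1 subr_lt0 ltNge; apply/negP => small.
pose X := M%:R * L.
have X1 : 1 <= X by apply: mulr_ege1 => //; lra.
have mX : m%:R <= X.
  apply: le_trans mle _; rewrite ler_pM2r; last lra.
  by nra.
have rhoN : rho * (M * d)%:R <= 16 * X ^+ 4.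
  have : rho * (M * d)%:R <= rho * (4 * m%:R) + rho * y%:R * m%:R ^+ 2.
    rewrite -mulrA -mulrDr ler_pM2l // -natrX -!natrM -natrD ler_nat.
    by rewrite [(y * _)%N]mulnC mulnC [(m ^ 2 * y)%N]mulnC mulnC.
  move=> /le_trans; apply; have m0 : 0 <= m%:R :> R by [].
  have ry : rho * y%:R <= 12 * X ^+ 2.
    rewrite leNgt; apply/negP => /lt_le_trans /(_ small); apply/negP; rewrite -leNgt.
    have -> : 12 * X ^+ 2 = (6 * X) * (2 * X) by ring.
    apply: ler_pM => //.
    - by rewrite ln_ge0 // ler1n muln_gt0 d0 ltnW.
    - by rewrite -addn1 natrD natrD natrM; lra.
    - by apply: le_trans lnN _; rewrite /X; nra.
  have X3 : X <= X ^+ 4 by apply: ler_eXnr.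
  have rm : rho * (4 * m%:R) <= 4 * X by nra.
  have rym : rho * y%:R * m%:R ^+ 2 <= 12 * X ^+ 2 * X ^+ 2.
    apply: ler_pM => //; first by rewrite mulr_ge0 // ltW.
    by apply: lerXn2r; rewrite ?nnegrE //; lra.
  have -> : 16 * X ^+ 4 = 4 * X ^+ 4 + 12 * X ^+ 2 * X ^+ 2 by ring.
  by apply: lerD => //; lra.
have : expR (e / 2 * L) <= rho * (M * d)%:R.
  rewrite natrM dL; apply: (@le_trans _ _ (rho * expR L)); last first.
    by rewrite ler_pM2l // ler_peMl ?expR_ge0 //; lra.
  rewrite (_ : e / 2 * L = - ((1 - e / 2) * L) + L); last by ring.
  by rewrite expRD ler_pM2r ?expR_gt0.
move=> /le_trans /(_ rhoN); apply/negP; rewrite -ltNge.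
apply: lt_le_trans (expR_ge1Dxn 4 _); last by apply: mulr_ge0; lra.
have -> : (5`!)%:R = 120 :> R by [].
have L4 : 0 < L ^+ 4 by apply: exprn_gt0; lra.
move: dlarge; rewrite ler_pdivrMr // -(ler_pM2l L4) => dlarge.
have -> : (e / 2 * L) ^+ 5 / 120 = L ^+ 4 * (L * e ^+ 5) / (120 * 32) by field.
have -> : 16 * X ^+ 4 = L ^+ 4 * ((16 * 120 * 32) * M%:R ^+ 4) / (120 * 32).
  by rewrite /X; field.
by lra.
Qed.

(** A random bipartite graph with [M * d] vertices on each side has density
    [1 / M]. With [M] constant, a set of [m] vertices leaves undominated a
    proportion of about [expR (- m / M)], so that nearly [M * ln d] vertices are
    needed on each side, a proportion [ln d / d] of them; taking [M] of order
    [4 / e] keeps [- ln (1 - 1 / M)] close enough to [1 / M]. *)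
Lemma regular_graph_large_domination (R : realType) (e : R) : 0 < e < 1 ->
  exists d0 : nat, forall d : nat, (d0 <= d)%N ->
    exists (H : sgraph) (t : nat), [/\ connected_graph H, regular_graph H d,
      forall D : {set H}, cnbrs D = setT -> (t <= #|D|)%N
      & (1 - e) * (ln d%:R / d%:R) <= t%:R / #|H|%:R].
Proof.
move=> /[dup] e01 /andP[e0 e1].
pose M := (Num.truncn (4 / e)).+1.
have M4 : 4 < M%:R * e by rewrite -ltr_pdivrMr //; exact: truncnS_gt.
have M4' : 4 < M%:R :> R.
  by apply: lt_le_trans M4 _; rewrite ler_piMr // ltW.
have M1 : (1 < M)%N by rewrite -(ltr_nat R); lra.
have [n0 large] := ln_nat_large (16 * 120 * 32 * M%:R ^+ 4 / e ^+ 5).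
exists (maxn n0 2) => d; rewrite geq_max => /andP[/large[d0 Ld] d2].
set L := ln d%:R in Ld *.
have L2 : 2 <= L.
  have e5 : 0 < e ^+ 5 by rewrite exprn_gt0.
  have e51 : e ^+ 5 <= 1 by apply: exprn_ile1; lra.
  have M41 : 1 <= M%:R ^+ 4 :> R by apply: exprn_ege1; lra.
  apply: le_trans Ld; rewrite ler_pdivlMr //; lra.
pose a := (1 - e / 2) * (M%:R - 1) : R.
have a1 : 1 <= a by rewrite /a; nra.
have aL : 1 <= a * L by apply: mulr_ege1 => //; lra.
pose m := Num.truncn (a * L).
have /andP[mle mgt] : m%:R <= a * L < m.+1%:R by apply: truncn_itv; lra.
have m0 : (0 < m)%N by rewrite -ltnS -(ltr_nat R); lra.
have Md : d%:R <= (M * d)%:R * M%:R^-1 :> R.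
  by rewrite natrM mulrAC divff ?mul1r // gt_eqF //; lra.
have p01 : 0 <= (M%:R^-1 : R) <= 1 by rewrite invr_ge0 invf_le1; lra.
have N1 : (1 < M * d)%N by rewrite (leq_trans M1) // leq_pmulr.
have [y yN|H [Hconn Hd cH Hdom]] :=
    regular_graph_no_small_domination p01 m0 d2 N1 Md.
  exact: union_bound_small e01 M1 d0 Ld mle yN.
exists H, (2 * m).+1; split => //; rewrite cH.
have d0' : 0 < d%:R :> R by rewrite ltr0n.
rewrite !natrM -addn1 natrD natrM.
rewrite ler_pdivlMr; last by do 2 ?apply: mulr_gt0 => //; lra.
have -> : (1 - e) * (L / d%:R) * (2 * (M%:R * d%:R)) = 2 * M%:R * (1 - e) * L.
  by field; rewrite gt_eqF.
apply: (@le_trans _ _ (2 * (a * L) - 1)); last by move: mgt; rewrite -addn1 natrD; lra.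
by rewrite /a; nra.
Qed.

Lemma pd_ratio_lower_bound (R : realType) (k : nat) (eps : R) : 0 < eps ->
  exists r0 : nat, forall r : nat, (r0 <= r)%N ->
    let q := (2 * uphalf k.+1)%N in
    let d := (r %/ q)%N in
    (1 - eps) * (ln d%:R / (q * d)%:R) <= pd_ratio R k r.
Proof.
move=> eps0; pose e : R := Num.min eps (1 / 2).
have e01 : 0 < e < 1.
  by rewrite /e lt_min eps0 gt_min; apply/andP; split; [|apply/orP; right]; lra.
have [d0 graph] := regular_graph_large_domination e01.
pose q := (2 * uphalf k.+1)%N.
have kq : (k < q)%N.
  by rewrite /q uphalf_half -[X in (X <= _)%N]odd_double_half -muln2; lia.
have q0 : (0 < q)%N by apply: leq_ltn_trans kq.
exists (maxn d0 1 * q)%N => r r0r; rewrite -/q.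
have : (maxn d0 1 <= r %/ q)%N by rewrite leq_divRL.
set d := (r %/ q)%N => /=; rewrite geq_max => /andP[/graph[H [t [Hconn Hd Ht]]] ht d1].
have d1' : 0 < d%:R :> R by rewrite ltr0n.
have q0' : 0 < q%:R :> R by rewrite ltr0n.
rewrite [r in leRHS](divn_eq r q).
apply: le_trans (pd_ratio_ge R Hconn Hd Ht d1 kq (ltn_pmod r q0)).
have -> : t%:R / (#|H| * (2 * uphalf k.+1))%:R = t%:R / #|H|%:R / q%:R :> R.
  by rewrite natrM invfM mulrA.
rewrite ler_pdivlMr //; apply: le_trans ht.
have -> : (1 - eps) * (ln d%:R / (q * d)%:R) * q%:R
    = (1 - eps) * (ln d%:R / d%:R).
  by rewrite natrM; field; rewrite !gt_eqF.
apply: ler_wpM2r; first by rewrite divr_ge0 // ln_ge0 // ler1n.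
by rewrite lerD2l lerN2 /e ge_min lexx.
Qed.

(** The probability [1 - r.+1 ^ (- 1 / r)] is the one that minimises the bound
    [p + (1 - p) ^+ r.+1]. *)
Lemma pd_ratio_upper_bound (R : realType) (k r : nat) : (0 < r)%N ->
  pd_ratio R k r <= 1 - r%:R / r.+1%:R `^ (1 + 1 / r%:R).
Proof.
move=> r0; have r0' : 0 < r%:R :> R by rewrite ltr0n.
have s0 : 0 < r.+1%:R :> R by rewrite ltr0n.
pose a : R := r.+1%:R `^ (- (1 / r%:R)).
have a0 : 0 < a by rewrite powR_gt0.
have a1 : a <= 1.
  rewrite /a powRN invf_le1 ?powR_gt0 //.
  by rewrite -[leLHS](powRr0 r.+1%:R) ler_powR // ?ler1n // divr_ge0.
have ar : a ^+ r = r.+1%:R^-1.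
  rewrite -powR_mulrn ?ltW // /a -powRrM mulNr mul1r mulVf ?gt_eqF //.
  by rewrite powR_inv1 // ltW.
have p01 : 0 <= 1 - a <= 1 by lra.
have -> : r.+1%:R `^ (1 + 1 / r%:R) = r.+1%:R / a :> R.
  rewrite /a powRN invrK powRD ?powRr1 ?ltW //.
  by apply/implyP => _; rewrite gt_eqF.
apply: le_trans (pd_ratio_le k r p01) _; rewrite le_eqVlt; apply/orP; left.
rewrite subKr exprS ar -natr1; apply/eqP; field.
by rewrite natr1 !gt_eqF.
Qed.

Local Open Scope classical_set_scope.
Local Open Scope ring_scope.

(* [uphalf n] is the ceiling of [n / 2]. *)
Theorem theorem1p2 (R : realType) (k : nat) (k_ge1 : (1 <= k)%N) :
  (forall eps : R, 0 < eps ->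
     exists r0 : nat, forall r : nat, (r0 <= r)%N ->
       let q := (2 * uphalf k.+1)%N in
       let d := (r %/ q)%N in
       (1 - eps) * (ln d%:R / (q * d)%:R) <= pd_ratio R k r
         <= 1 - r%:R / r.+1%:R `^ (1 + 1 / r%:R))
  /\ (fun r : nat => pd_ratio R k r / (ln r%:R / r%:R)) @ \oo --> (1 : R).
Proof.
split.
  move=> eps /(pd_ratio_lower_bound k)[r0 lower].
  exists (maxn r0 1) => r; rewrite geq_max => /andP[/lower /= lb r1] /=.
  by rewrite lb pd_ratio_upper_bound.
apply/cvgrPdist_le => eps eps0.
pose e : R := Num.min eps 1 / 2.
have e0 : 0 < e by rewrite divr_gt0 // lt_min eps0 ltr01.
have e2 : 2 * e <= eps by rewrite mulrC divfK // ge_min lexx.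
have e1 : 2 * e <= 1 by rewrite mulrC divfK // ge_min lexx orbT.
have [r0 lower] := pd_ratio_lower_bound k e0.
have [r1 large1] := ln_nat_large (ln (2 * (2 * uphalf k.+1))%:R / e).
have [r2 large2] := ln_nat_large (eps^-1 + 1).
exists (maxn (maxn r1 r2) (maxn r0 (2 * uphalf k.+1))) => // r /=.
rewrite !geq_max => /andP[/andP[/large1[rpos rL1] /large2[_ rL2]]].
move=> /andP[/lower /= rlower qr].
have [epsi0 rpos'] : 0 < eps^-1 /\ 0 < r%:R :> R by rewrite invr_gt0 ltr0n.
have L0 : 0 < ln r%:R :> R by lra.
have scale : 0 < ln r%:R / r%:R :> R by rewrite divr_gt0.
rewrite ler_distlC; apply/andP; split.
  rewrite ler_pdivlMr //; apply: le_trans rlower.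
  (* Since [r / 2 <= q * d <= r], replacing [ln d / (q * d)] by [ln r / r] costs
     one more factor [1 - e]. *)
  set q := (2 * uphalf k.+1)%N in rL1 qr *; set d := (r %/ q)%N.
  have q0 : (0 < q)%N by rewrite /q muln_gt0.
  have d0 : (0 < d)%N by rewrite /d divn_gt0.
  have qdr : (q * d <= r)%N by rewrite mulnC leq_trunc_div.
  have rqd : (r <= 2 * q * d)%N.
    by have := ltn_ceil r q0; rewrite -/d; nia.
  have qd0 : 0 < (q * d)%:R :> R by rewrite ltr0n muln_gt0 q0.
  have d0' : 0 < d%:R :> R by rewrite ltr0n.
  have lnd : (1 - e) * ln r%:R <= ln d%:R.
    have : ln r%:R <= ln (2 * q)%:R + ln d%:R :> R.
      rewrite -lnM ?posrE ?ltr0n ?muln_gt0 // -natrM.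
      by rewrite ler_ln ?posrE ?ltr0n ?muln_gt0 ?q0 // ler_nat.
    by move: rL1; rewrite ler_pdivrMr //; lra.
  apply: (@le_trans _ _ ((1 - e) * ((1 - e) * ln r%:R / r%:R))).
    by rewrite !mulrA !ler_pM2r ?invr_gt0 //; nra.
  rewrite ler_pM2l; last lra.
  apply: ler_pM => //; first by apply: mulr_ge0; lra.
  by rewrite lef_pV2 ?posrE // ler_nat.
rewrite ler_pdivrMr //.
(* The probability [ln r / r] is close enough to the optimal one, and leaves
   each vertex undominated with probability at most [1 / r]. *)
have p01 : 0 <= (ln r%:R / r%:R : R) <= 1.
  by rewrite ltW //= ler_pdivrMr // mul1r ltW // ln_sublinear.
apply: le_trans (pd_ratio_le k r p01) _; rewrite mulrDl mul1r lerD2l.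
apply: (@le_trans _ _ (expR (- ln r%:R))).
  apply: (@le_trans _ _ ((1 - ln r%:R / r%:R) ^+ r)).
    by rewrite exprS ler_piMl ?exprn_ge0; lra.
  have -> : - ln r%:R = - (ln r%:R / r%:R) * r%:R :> R.
    by rewrite mulNr divfK // gt_eqF.
  rewrite expRM_natr; apply: lerXn2r; rewrite ?nnegrE ?expR_ge0 //; first lra.
  exact: expR_ge1Dx.
rewrite expRN lnK ?posrE // mulrA -[leLHS]mul1r ler_pM2r ?invr_gt0 //.
by rewrite -ler_pdivrMl // mulr1; lra.
Qed.
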